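(* Let $\mathcal{H}=\mathbb{R}^d$ and let $$f(x)=\sum_{k=1}^{m}\max_{i\in I_k}g_{ki}(x)+\sum_{l=1}^{s}\min_{j\in J_l}u_{lj}(x),\qquad I_k=\{1,\dots,p_k\},\quad J_l=\{1,\dots,q_l\},$$ where the functions $g_{ki},u_{lj}\colon\mathbb{R}^d\to\mathbb{R}$ are continuously differentiable and their gradients are locally Lipschitz continuous. Consider the quadratic regularization of the method of codifferential descent (QR-MCD) for the function $f$ with $\alpha_*\ge1$, $\nu_n\equiv+\infty$ and $\lim_{n\to\infty}\mu_n>0$. Suppose that a sequence $\{x_n\}$ generated by this method converges to a point $x^*$ such that for any $\lambda\in J(x^* )$ the point $x^*$ is a Haar point of the function $f_\lambda$. Then $x^*$ is a point of strict local minimum of $f$, and $x_n\to x^*$ as $n\to\infty$ quadratically.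
   Context: Put $g_k(x)=\max_{i\in I_k}g_{ki}(x)$, $u_l(x)=\min_{j\in J_l}u_{lj}(x)$, and for $\nu,\mu\in[0,+\infty]$ let $I_{k,\nu}(x)=\{i\in I_k\mid g_{ki}(x)\ge g_k(x)-\nu\}$, $J_{l,\mu}(x)=\{j\in J_l\mid u_{lj}(x)\le u_l(x)+\mu\}$. Let $I=I_1\times\dots\times I_m$, $I(x)=I_{1,0}(x)\times\dots\times I_{m,0}(x)$ and $J(x)=J_{1,0}(x)\times\dots\times J_{s,0}(x)$. Define the finite subsets of $\mathbb{R}\times\mathbb{R}^d$ (Minkowski sums) $$\underline{d}_\nu f(x)=\sum_{k=1}^m\{(g_{ki}(x)-g_k(x),\nabla g_{ki}(x))\mid i\in I_{k,\nu}(x)\},\qquad\overline{d}_\mu f(x)=\sum_{l=1}^s\{(u_{lj}(x)-u_l(x),\nabla u_{lj}(x))\mid j\in J_{l,\mu}(x)\}.$$ For a multi-index $\lambda=(j_1,\dots,j_s)\in J_1\times\dots\times J_s$ let $$f_\lambda(x)=\sum_{k=1}^m\max_{i\in I_k}g_{ki}(x)+\sum_{l=1}^su_{lj_l}(x),\qquad\underline{d}f_\lambda(x)=\sum_{k=1}^m\operatorname{co}\{(g_{ki}(x)-g_k(x),\nabla g_{ki}(x))\mid i\in I_k\}+\Big(0,\sum_{l=1}^s\nabla u_{lj_l}(x)\Big).$$ If $0\in\underline{d}f_\lambda(x^* )$, denote by $\alpha_\lambda(x^* )$ the (nonempty) set of all families $\alpha=\{\alpha_\zeta\}_{\zeta\in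 I}$ with $\alpha_\zeta\ge0$, $\alpha_\zeta=0$ for $\zeta\notin I(x^* )$, $\sum_{\zeta\in I}\alpha_\zeta=1$, and $$\sum_{\zeta=(i_1,\dots,i_m)\in I}\alpha_\zeta\Big(\sum_{k=1}^m\nabla g_{ki_k}(x^* )\Big)+\sum_{l=1}^s\nabla u_{lj_l}(x^* )=0.$$ The point $x^*$ is called a Haar point of $f_\lambda$ if: (1) $0\in\underline{d}f_\lambda(x^* )$; (2) $|I(x^* )|=|I_{1,0}(x^* )|\cdots|I_{m,0}(x^* )|=d+1$ (cardinalities); (3) the vectors $\nabla g_{1i_1}(x^* )+\dots+\nabla g_{mi_m}(x^* )$, $(i_1,\dots,i_m)\in I(x^* )$, are affinely independent; (4) for any $\alpha\in\alpha_\lambda(x^* )$ one has $\alpha_\zeta>0$ for all $\zeta\in I(x^* )$. QR-MCD for $f$ (unconstrained, i.e. over $\mathbb{R}^d$). Choose $\{\nu_n\},\{\mu_n\}\subset[0,+\infty]$, $\alpha_*\in(0,+\infty]$ and $x_0\in\mathbb{R}^d$ (if $\alpha_*=+\infty$, then $[0,\alpha_*]$ means $[0,+\infty)$). At iteration $n\ge0$: for every $z\in\overline{d}_{\mu_n}f(x_n)$ let $h_n(z)$ be the unique minimizer over $h\in\mathbb{R}^d$ of $$\varphi_n(h,z)=\max_{(a,v)\in\operatorname{co}\underline{d}_{\nu_n}f(x_n)+z}\big(a+\langle v,h\rangle\big)+\tfrac12\|h\|^2;$$ choose $\alpha_n(z)\in\arg\min\{f(x_n+\alpha h_n(z))\mid\alpha\in[0,\alpha_*]\}$;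 choose $z_n\in\arg\min\{f(x_n+\alpha_n(z)h_n(z))\mid z\in\overline{d}_{\mu_n}f(x_n)\}$; and set $x_{n+1}=x_n+\alpha_n(z_n)h_n(z_n)$. It is assumed that $\alpha_n(z)$ and $z_n$ are well defined at every iteration. Quadratic convergence $x_n\to x^*$ means that $x_n\to x^*$ and there exist $C>0$ and $n_0$ such that $\|x_{n+1}-x^*\|\le C\|x_n-x^*\|^2$ for all $n\ge n_0$. *)

(* Defs.v *)
From HB Require Import structures.
From mathcomp Require Export all_boot all_order all_algebra.
From mathcomp Require Export all_classical all_reals all_analysis.

Set Implicit Arguments.
Unset Strict Implicit.
Unset Printing Implicit Defensive.

Import Order.TTheory GRing.Theory Num.Theory.
Export numFieldNormedType.Exports.

Local Open Scope classical_set_scope.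
Local Open Scope ring_scope.

Section Euclidean.
Context {R : realType} {d : nat}.
Local Notation vec := 'rV[R]_d.

Definition dotp (v w : vec) : R := \sum_i v 0 i * w 0 i.

(* The library norm on 'rV[R]_d is the sup norm; it induces the same topology
   and the same Lipschitz functions as this one. *)
Definition enorm (v : vec) : R := Num.sqrt (dotp v v).

Definition grad (f : vec -> R) (x : vec) : vec :=
  \row_i 'D_(delta_mx 0 i) f x.

Definition C1 (f : vec -> R) : Prop :=
  (forall x, differentiable f x) /\ continuous (grad f).

Definition loc_lipschitz_grad (f : vec -> R) : Prop :=
  forall x : vec, exists2 U : set vec, nbhs x U & [lipschitz grad f y | y in U].

Definition strict_local_min (f : vec -> R) (xs : vec) : Prop :=
  \forall y \near xs^', f xs < f y.

Definition cvg_quadratically (x : nat -> vec) (xs : vec) : Prop :=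
  x @ \oo --> xs /\
  exists2 C : R, 0 < C &
    \forall n \near \oo, enorm (x n.+1 - xs) <= C * enorm (x n - xs) ^+ 2.

End Euclidean.

Definition argmin {R : realType} {T : Type} (A : set T) (F : T -> R) : set T :=
  [set t | A t /\ forall t', A t' -> F t <= F t'].

Definition conv_hull {R : realType} {V : lmodType R} (A : set V) : set V :=
  smallest (@convex_set R V) A.

Definition minkowski_sum {V : zmodType} {n : nat} (A : 'I_n -> set V) : set V :=
  [set \sum_k w k | w in [set w : 'I_n -> V | forall k, A k (w k)]].

(* The pieces of a single maximum (resp. minimum) are indexed by 'I_n.+1, so
   that the index set is nonempty. *)
Section Pieces.
Context {R : realType} {d n : nat}.
Local Notation vec := 'rV[R]_d.
Implicit Types (G U : 'I_n.+1 -> vec -> R) (x : vec).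

Definition fmax G x : R := \big[Num.max/G ord0 x]_i G i x.
Definition fmin U x : R := \big[Num.min/U ord0 x]_j U j x.

Definition act_max G (nu : \bar R) x : {set 'I_n.+1} :=
  finset (fun i => ((fmax G x)%:E - nu <= (G i x)%:E)%E).
Definition act_min U (mu : \bar R) x : {set 'I_n.+1} :=
  finset (fun j => ((U j x)%:E <= (fmin U x)%:E + mu)%E).

Definition codiff_max G (nu : \bar R) x : set (R^o * vec)%type :=
  [set (G i x - fmax G x, grad (G i) x) | i in [set` act_max G nu x]].
Definition codiff_min U (mu : \bar R) x : set (R^o * vec)%type :=
  [set (U j x - fmin U x, grad (U j) x) | j in [set` act_min U mu x]].

End Pieces.

(* [p k] and [q l] are the numbers of pieces minus one. *)
Section Problem.
Context {R : realType} {d m s : nat} {p : 'I_m -> nat} {q : 'I_s -> nat}.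
Local Notation vec := 'rV[R]_d.
Local Notation pt := (R^o * vec)%type.
Variable g : forall k : 'I_m, 'I_(p k).+1 -> vec -> R.
Variable u : forall l : 'I_s, 'I_(q l).+1 -> vec -> R.

Definition obj (x : vec) : R :=
  \sum_k fmax (@g k) x + \sum_l fmin (@u l) x.

Definition lower_codiff (nu : \bar R) (x : vec) : set pt :=
  minkowski_sum (fun k => codiff_max (@g k) nu x).
Definition upper_codiff (mu : \bar R) (x : vec) : set pt :=
  minkowski_sum (fun l => codiff_min (@u l) mu x).

Definition idxI := {dffun forall k : 'I_m, 'I_(p k).+1}.
Definition idxJ := {dffun forall l : 'I_s, 'I_(q l).+1}.

Definition Iact (x : vec) : {set idxI} :=
  finset (fun zeta : idxI => [forall k, zeta k \in act_max (@g k) 0%E x]).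
Definition Jact (x : vec) : {set idxJ} :=
  finset (fun la : idxJ => [forall l, la l \in act_min (@u l) 0%E x]).

Definition obj_la (la : idxJ) (x : vec) : R :=
  \sum_k fmax (@g k) x + \sum_l u (la l) x.

Definition codiff_la (la : idxJ) (x : vec) : set pt :=
  [set w + (0, \sum_l grad (u (la l)) x) | w in
     minkowski_sum (fun k => conv_hull (codiff_max (@g k) +oo%E x))].

Definition grad_sum (zeta : idxI) (x : vec) : vec :=
  \sum_k grad (g (zeta k)) x.

Definition multipliers (la : idxJ) (x : vec) : set (idxI -> R) :=
  [set al : idxI -> R |
    [/\ forall zeta, 0 <= al zeta,
        forall zeta, zeta \notin Iact x -> al zeta = 0,
        \sum_zeta al zeta = 1
      & \sum_zeta al zeta *: grad_sum zeta x
          + \sum_l grad (u (la l)) x = 0]].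

Definition aff_indep {T : finType} (A : {set T}) (v : T -> vec) : Prop :=
  forall c : T -> R, \sum_(t in A) c t = 0 -> \sum_(t in A) c t *: v t = 0 ->
    forall t, t \in A -> c t = 0.

(* A Haar point of [obj_la la]; the notion depends on the given representation
   of that function through [g], [u] and [la], not just on its values. *)
Definition haar_point (la : idxJ) (x : vec) : Prop :=
  [/\ codiff_la la x 0,
      #|Iact x| = d.+1,
      aff_indep (Iact x) (fun zeta => grad_sum zeta x)
    & forall al, multipliers la x al ->
        forall zeta, zeta \in Iact x -> 0 < al zeta].

(* The supremum is a maximum: the convex hull of a nonempty finite set is
   compact. *)
Definition qr_model (nu : \bar R) (x : vec) (z : pt) (h : vec) : R :=
  sup [set w.1 + dotp w.2 h | w in
         [set w + z | w in conv_hull (lower_codiff nu x)]]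
  + 2^-1 * enorm h ^+ 2.

Definition steps (alpha_max : \bar R) : set R :=
  [set a : R | 0 <= a /\ (a%:E <= alpha_max)%E].

Definition qr_mcd (nu mu : nat -> \bar R) (alpha_max : \bar R)
    (x : nat -> vec) : Prop :=
  exists (h : nat -> pt -> vec) (alpha : nat -> pt -> R) (z : nat -> pt),
  forall n,
    [/\ forall w, upper_codiff (mu n) (x n) w ->
          argmin setT (qr_model (nu n) (x n) w) = [set h n w],
        forall w, upper_codiff (mu n) (x n) w ->
          argmin (steps alpha_max) (fun a => obj (x n + a *: h n w))
            (alpha n w),
        argmin (upper_codiff (mu n) (x n))
          (fun w => obj (x n + alpha n w *: h n w)) (z n)
      & x n.+1 = x n + alpha n (z n) *: h n (z n)].

End Problem.

(* Main.v *)
Require Import Defs.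
From mathcomp Require Import all_boot all_order all_algebra.
From mathcomp Require Import all_classical all_reals all_analysis.
From mathcomp Require Import ring lra.

Set Implicit Arguments.
Unset Strict Implicit.
Unset Printing Implicit Defensive.

Import Order.TTheory GRing.Theory Num.Theory.

Local Open Scope classical_set_scope.
Local Open Scope ring_scope.

(** Write a branch of the objective for one choice of a piece in every maximum
    and every minimum, so that [f] is the minimum over [la] of the maximum over
    [zeta] of the branches.  Each branch has a first order expansion near [xs]
    with a quadratic remainder, uniformly in the base point ([has_taylor]).

    _Sharpness._  A Haar point turns first order stationarity into linear
    growth.  The inclusion of [0] in the codifferential yields convex
    multipliers on the active gradients ([haar_multipliers]); they are positive
    and the [d + 1] active gradients are affinely independent, hence [0] is
    interior to the convex hull of the gradients and the largest slope in
    direction [h] is at least [`|h| / T] for some [T > 0] ([haar_sharp]).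
    Near [xs] only those [la] that are active at [xs] can realise the minimum
    ([near_Jact]), so [f y - f xs] dominates [`|y - xs|] ([obj_sharp]): this is
    the strict local minimum.

    _One step._  Let [y] be an iterate, [e = xs - y], and take [la] active at
    [y]; its codifferential vertex is one of those tried by the method.  The
    linearised branches at [y + e = xs] equal the branches there up to
    [O(`|e|^2)], so the model at [e], up to its constant term, is at most
    [f xs + O(`|e|^2)].  The minimizer [h] does at least as well, while
    sharpness, which survives the small change of gradients between [xs] and
    [y], makes the model exceed [f xs] by a multiple of [`|h - e|] minus
    [O(`|e|^2)].
    Comparing both gives [`|y + h - xs| = O(`|e|^2)] ([model_step_error]); the
    regularisation [`|e|^2 / 2] is of the same order and does no harm.  Thus the
    quadratic error comes from comparing two values of the model, without
    describing its minimizer by a system of equations.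

    _Conclusion._  The step length [1] is admissible, so the next iterate has
    an objective value at most [f (y + h)], which is [f xs + O(`|e|^2)] because
    [f] grows at most linearly at [xs] ([obj_calm]).  Linear growth from below
    converts this bound on the value into the bound [O(`|e|^2)] on the distance
    of the next iterate to [xs].  All estimates are made in the sup norm and
    converted to the Euclidean norm at the end. *)

(** * Euclidean and sup norms *)

Section Dotp.
Context {R : realType} {d : nat}.
Implicit Types (v w : 'rV[R]_d) (a : R).

Lemma dotpDl v1 v2 w : dotp (v1 + v2) w = dotp v1 w + dotp v2 w.
Proof.
by rewrite -big_split; apply: eq_bigr => i _ /=; rewrite mxE mulrDl.
Qed.

Lemma dotpZl a v w : dotp (a *: v) w = a * dotp v w.
Proof. by rewrite mulr_sumr; apply: eq_bigr => i _; rewrite mxE mulrA. Qed.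

Lemma dotpC v w : dotp v w = dotp w v.
Proof. by apply: eq_bigr => i _; rewrite mulrC. Qed.

Lemma dotpDr v w1 w2 : dotp v (w1 + w2) = dotp v w1 + dotp v w2.
Proof. by rewrite dotpC dotpDl !(dotpC v). Qed.

Lemma dotp0l w : dotp 0 w = 0.
Proof. by rewrite -(scale0r 0) dotpZl mul0r. Qed.

Lemma dotpBl v1 v2 w : dotp (v1 - v2) w = dotp v1 w - dotp v2 w.
Proof. by rewrite dotpDl -scaleN1r dotpZl mulN1r. Qed.

Lemma dotp_suml (I : finType) (P : pred I) (c : I -> R) (V : I -> 'rV[R]_d) w :
  dotp (\sum_(i | P i) c i *: V i) w = \sum_(i | P i) c i * dotp (V i) w.
Proof.
elim/big_ind2 : _ => [|v1 a1 v2 a2 <- <-|i _]; first exact: dotp0l.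
  exact: dotpDl.
exact: dotpZl.
Qed.

Lemma dotp_delta (j : 'I_d) w : dotp (delta_mx 0 j) w = w 0 j.
Proof.
rewrite /dotp (bigD1 j) //= mxE !eqxx mul1r big1 ?addr0 // => i ij.
by rewrite mxE (negbTE ij) andbF mul0r.
Qed.

Lemma dotp_ge0 v : 0 <= dotp v v.
Proof. by apply: sumr_ge0 => i _; rewrite -expr2 sqr_ge0. Qed.

Lemma sqr_enorm v : enorm v ^+ 2 = dotp v v.
Proof. by rewrite sqr_sqrtr // dotp_ge0. Qed.

Lemma coord_le_norm v i : `|v 0 i| <= `|v|.
Proof.
rewrite [leRHS]mx_normrE.
exact: (le_bigmax 0 (fun ij : 'I_1 * 'I_d => `|v ij.1 ij.2|) (0, i)).
Qed.

Lemma norm_le_coord v a : 0 <= a -> (forall i, `|v 0 i| <= a) -> `|v| <= a.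
Proof.
move=> a0 va; rewrite [leLHS]mx_normrE; apply/bigmax_leP; split=> // -[i j] _.
by rewrite /= ord1.
Qed.

Lemma dotp_le v w : `|dotp v w| <= d%:R * (`|v| * `|w|).
Proof.
apply: le_trans (ler_norm_sum _ _ _) _.
rewrite mulr_natl -[X in _ *+ X](card_ord d) -sumr_const.
by apply: ler_sum => i _; rewrite normrM ler_pM // coord_le_norm.
Qed.

Lemma norm_le_enorm v : `|v| <= enorm v.
Proof.
apply: norm_le_coord => [|i]; first exact: sqrtr_ge0.
rewrite -sqrtr_sqr ler_wsqrtr // /dotp (bigD1 i) //= -expr2 lerDl.
by apply: sumr_ge0 => j _; rewrite -expr2 sqr_ge0.
Qed.

Lemma enorm_le_norm v : enorm v <= d%:R * `|v|.
Proof.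
rewrite -[leRHS]ger0_norm ?mulr_ge0 // -sqrtr_sqr ler_wsqrtr //.
apply: le_trans (ler_norm _) _; apply: le_trans (dotp_le _ _) _.
rewrite exprMn -expr2 ler_wpM2r ?sqr_ge0 // -natrX ler_nat.
by case: (d) => // n; rewrite leq_pmulr.
Qed.

End Dotp.

(** * First order expansions with quadratic remainder *)

Section Taylor.
Context {R : realType} {d : nat}.
Local Notation vec := 'rV[R]_d.
Implicit Types (f : vec -> R) (x y z xs : vec).

Lemma differential_dotp f x v : differentiable f x ->
  'd f x v = dotp (grad f x) v.
Proof.
move=> df; rewrite {1}[v]row_sum_delta linear_sum; apply: eq_bigr => i _.
by rewrite linearZ_LR mxE deriveE // [RHS]mulrC.
Qed.

Lemma is_derive_line f y w (t : R) : differentiable f (y + t *: w) ->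
  is_derive t (1 : R) (fun s : R => f (y + s *: w)) (dotp (grad f (y + t *: w)) w).
Proof.
move=> df; have dw := @diff_derivable _ _ _ _ _ w df.
(* The two difference quotients are the same function of the increment. *)
have E : (fun h : R => h^-1 *: (f (y + (h *: (1 : R^o) + t) *: w) - f (y + t *: w)))
       = (fun h : R => h^-1 *: (f (h *: w + (y + t *: w)) - f (y + t *: w))).
  apply/funext => h; congr (_ *: (f _ - _)).
  by rewrite scalerDl scaler1 addrCA.
split; first by rewrite /derivable E.
by rewrite /derive E -differential_dotp // -deriveE.
Qed.

Lemma mean_value f y z : (forall x, differentiable f x) ->
  exists2 t : R, 0 <= t <= 1 &
    f z - f y = dotp (grad f (y + t *: (z - y))) (z - y).
Proof.
move=> df; set w := z - y.
have dl (t : R) : is_derive t (1 : R) (fun s : R => f (y + s *: w))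
    (dotp (grad f (y + t *: w)) w) by exact: is_derive_line.
have [|t t01] := @MVT_segment R (fun s : R => f (y + s *: w))
    (fun t => dotp (grad f (y + t *: w)) w) 0 1 ler01.
  apply: continuous_subspaceT => t; apply: differentiable_continuous.
  by apply/derivable1_diffP; case: (dl t).
rewrite scale1r scale0r addr0 subr0 mulr1 {1}/w subrKC => E.
by exists t => //; move: t01; rewrite in_itv.
Qed.

Lemma ball_segment xs (r : R) y z t : 0 <= t <= 1 ->
  ball xs r y -> ball xs r z -> ball xs r (y + t *: (z - y)).
Proof.
move=> /andP[t0 t1]; rewrite -!ball_normE /ball_ /= => yr zr.
have -> : xs - (y + t *: (z - y)) = (1 - t) *: (xs - y) + t *: (xs - z).
  by apply/rowP => i; rewrite !mxE; ring.
apply: le_lt_trans (ler_normD _ _) _; rewrite !normrZ.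
rewrite [`|1 - t|]ger0_norm ?subr_ge0 // [`|t|]ger0_norm //.
have [->|tn0] := eqVneq t 0; first by rewrite mul0r addr0 subr0 mul1r.
have : t * `|xs - z| < t * r by rewrite ltr_pM2l // lt_def tn0.
have : (1 - t) * `|xs - y| <= (1 - t) * r by rewrite ler_wpM2l ?subr_ge0 // ltW.
lra.
Qed.

(** The base point [y] of the expansion varies over the ball, since the method
    linearises at the iterates and not at [xs].  The gradient is an abstract
    [G] so that the notion is visibly stable under sums. *)
Definition taylor (K r : R) xs f (G : vec -> vec) :=
  forall y z, ball xs r y -> ball xs r z ->
    `|f z - f y - dotp (G y) (z - y)| <= K * `|z - y| ^+ 2 /\
    `|G z - G y| <= K * `|z - y|.

Definition has_taylor xs f G :=
  exists K r : R, [/\ 0 < K, 0 < r & taylor K r xs f G].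

Lemma taylorS (K K' r r' : R) xs f G : K <= K' -> r' <= r ->
  taylor K r xs f G -> taylor K' r' xs f G.
Proof.
move=> KK rr T y z /(le_ball rr) yr /(le_ball rr) zr.
have [T1 T2] := T y z yr zr; split.
  by apply: le_trans T1 _; rewrite ler_wpM2r ?sqr_ge0.
by apply: le_trans T2 _; rewrite ler_wpM2r.
Qed.

Lemma C1_has_taylor f xs : C1 f -> loc_lipschitz_grad f ->
  has_taylor xs f (grad f).
Proof.
move=> [df _] /(_ xs)[U /nbhs_ballP[r /= r0 rU] [M [_ lip]]].
pose L := `|M| + 1.
have L0 : 0 < L by rewrite ltr_pwDr.
have {}lip y z : ball xs r y -> ball xs r z ->
    `|grad f z - grad f y| <= L * `|z - y|.
  move=> yr zr; apply: (lip L _ (z, y)); last by split; exact: rU.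
  by rewrite /L; apply: le_lt_trans (ler_norm M) _; rewrite ltrDl.
exists (d%:R * L + L), r; split => // [|y z yr zr].
  by rewrite ltr_wpDl // mulr_ge0 // ltW.
have n0 := normr_ge0 (z - y).
have dL0 : 0 <= d%:R * L by rewrite mulr_ge0 // ltW.
split; last first.
  by apply: le_trans (lip _ _ yr zr) _; rewrite ler_wpM2r // lerDr.
(* The remainder is the variation of the gradient between [y] and a point of
   the segment, which stays in the ball where the Lipschitz bound holds. *)
have [t t01 ->] := mean_value y z df.
have xr := ball_segment t01 yr zr.
rewrite -dotpBl; apply: le_trans (dotp_le _ _) _.
rewrite mulrDl ler_wpDr ?mulr_ge0 ?sqr_ge0 ?(ltW L0) //.
rewrite -mulrA ler_wpM2l // expr2 mulrA ler_wpM2r //.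
apply: le_trans (lip _ _ yr xr) _; rewrite ler_wpM2l ?(ltW L0) //.
rewrite addrC addKr normrZ ger0_norm ?(andP t01).1 //.
by rewrite ler_piMl // (andP t01).2.
Qed.

Lemma has_taylor0 xs : has_taylor xs (fun=> 0) (fun=> 0).
Proof.
exists 1, 1; split => // y z _ _.
by rewrite dotp0l !subrr !normr0 !mul1r sqr_ge0.
Qed.

Lemma has_taylorD xs f1 G1 f2 G2 :
  has_taylor xs f1 G1 -> has_taylor xs f2 G2 ->
  has_taylor xs (fun x => f1 x + f2 x) (fun x => G1 x + G2 x).
Proof.
move=> [K1 [r1 [K10 r10 T1]]] [K2 [r2 [K20 r20 T2]]].
exists (K1 + K2), (Num.min r1 r2); split; rewrite ?addr_gt0 ?lt_min ?r10 //.
have m1 : Num.min r1 r2 <= r1 by rewrite ge_min lexx.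
have m2 : Num.min r1 r2 <= r2 by rewrite ge_min lexx orbT.
move=> y z yr zr.
have [a1 b1] := T1 y z (le_ball m1 yr) (le_ball m1 zr).
have [a2 b2] := T2 y z (le_ball m2 yr) (le_ball m2 zr).
rewrite !mulrDl; split.
  apply: le_trans (lerD a1 a2); apply: le_trans (ler_normD _ _).
  by rewrite dotpDl le_eqVlt; apply/orP; left; apply/eqP; congr `|_|; ring.
by apply: le_trans (lerD b1 b2); rewrite opprD addrACA ler_normD.
Qed.

Lemma has_taylor_sum (I : finType) xs (f : I -> vec -> R) G :
  (forall i, has_taylor xs (f i) (G i)) ->
  has_taylor xs (fun x => \sum_i f i x) (fun x => \sum_i G i x).
Proof.
move=> T; rewrite unlock; elim: (index_enum I) => [|i s IH] /=.
  exact: has_taylor0.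
exact: has_taylorD.
Qed.

Lemma has_taylor_uniform (I : finType) xs (f : I -> vec -> R) G :
  (forall i, has_taylor xs (f i) (G i)) ->
  exists K r : R, [/\ 0 < K, 0 < r & forall i, taylor K r xs (f i) (G i)].
Proof.
move=> T.
suff [K [r [K0 r0 Kr]]] : exists K r : R, [/\ 0 < K, 0 < r &
    {in enum I, forall i, taylor K r xs (f i) (G i)}].
  by exists K, r; split=> // i; apply: Kr; rewrite mem_enum.
elim: (enum I) => [|i s [K [r [K0 r0 Kr]]]]; first by exists 1, 1.
have [K' [r' [K'0 r'0 Kr']]] := T i.
exists (Num.max K K'), (Num.min r r'); split.
- by rewrite lt_max K0.
- by rewrite lt_min r0.
move=> j; rewrite inE => /predU1P[->|/Kr {}Kr].
  by apply: taylorS Kr'; rewrite ?le_max ?ge_min lexx orbT.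
by apply: taylorS Kr; rewrite ?le_max ?ge_min lexx.
Qed.

End Taylor.

(** * Convex hulls *)

Section ConvexHull.
Context {R : realType} {V : lmodType R}.
Implicit Types (A C : set V) (v w : V).

Lemma convex_setE C : convex_set C <->
  forall v w (t : R), 0 <= t <= 1 -> C v -> C w -> C (t *: v + (1 - t) *: w).
Proof.
split=> [cC v w t /andP[t0 t1] Cv Cw|cC v w t]; last first.
  rewrite !inE => Cv Cw; apply: cC => //; apply/andP; split; first exact: ge0.
  exact: le1.
have t01 : Itv.spec (@Itv.num_sem R) (Itv.Real `[0%Z, 1%Z]) t.
  by rewrite /= /Itv.num_sem /= in_itv /= num_real t0 t1.
have := cC v w (Itv.mk t01); rewrite !inE; exact.
Qed.

Lemma conv_hull_sub A C :
  (forall v w (t : R), 0 <= t <= 1 -> C v -> C w -> C (t *: v + (1 - t) *: w)) ->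
  A `<=` C -> conv_hull A `<=` C.
Proof. by move=> /convex_setE cC AC; apply: smallest_sub. Qed.

Lemma sub_conv_hull A : A `<=` conv_hull A.
Proof. exact: sub_gen_smallest. Qed.

Lemma conv_hull_convex A v w (t : R) : 0 <= t <= 1 ->
  conv_hull A v -> conv_hull A w -> conv_hull A (t *: v + (1 - t) *: w).
Proof.
move=> t01 Av Aw C [cC AC].
by apply: (proj1 (convex_setE C) cC) => //; [apply: Av|apply: Aw].
Qed.

(** Each factor enters the hull in turn: with the other summands fixed, the
    points of one factor that keep the sum in the hull on the right form a
    convex set, so it suffices to know this for the generators of that factor.
    This avoids product weights on the set of multi-indices. *)
Lemma minkowski_conv_hull n (A : 'I_n -> set V) :
  minkowski_sum (fun k => conv_hull (A k)) `<=` conv_hull (minkowski_sum A).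
Proof.
(* [s] lists the factors that have already entered the hull. *)
suff H (s : seq 'I_n) (w : 'I_n -> V) :
    (forall k, if k \in s then conv_hull (A k) (w k) else A k (w k)) ->
    conv_hull (minkowski_sum A) (\sum_k w k).
  by move=> _ [w wA <-]; apply: (H (enum 'I_n)) => k; rewrite mem_enum; apply: wA.
elim: s w => [|k s IH] w ws.
  by apply: sub_conv_hull; exists w => // k; have := ws k.
have [ks|ks] := boolP (k \in s).
  by apply: IH => j; have := ws j; rewrite inE; case: eqP => // ->; rewrite ks.
pose S := \sum_(j | j != k) w j.
have -> : \sum_j w j = w k + S by rewrite (bigD1 k).
have {}IH v : A k v -> conv_hull (minkowski_sum A) (v + S).
  move=> Av; pose w' j := if j == k then v else w j.
  have -> : v + S = \sum_j w' j.
    rewrite (bigD1 k) //= /w' eqxx; congr (_ + _).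
    by apply: eq_bigr => j /negbTE ->.
  apply: IH => j; rewrite /w'; case: (eqVneq j k) => [->|jk].
    by rewrite (negbTE ks).
  by have := ws j; rewrite inE (negbTE jk).
have := ws k; rewrite mem_head; move: (w k).
apply: (@conv_hull_sub _ [set v | conv_hull (minkowski_sum A) (v + S)]) => //.
move=> v1 v2 t t01 /= h1 h2.
have -> : t *: v1 + (1 - t) *: v2 + S = t *: (v1 + S) + (1 - t) *: (v2 + S).
  by rewrite !scalerDr addrACA -[in RHS]scalerDl subrKC scale1r.
exact: conv_hull_convex.
Qed.

Lemma conv_hull_finite (I : finType) (P : I -> V) A w :
  (forall v, A v -> exists i, v = P i) -> conv_hull A w ->
  exists a : I -> R,
    [/\ forall i, 0 <= a i, \sum_i a i = 1 & w = \sum_i a i *: P i].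
Proof.
move=> AP; apply: (@conv_hull_sub A [set v | exists a : I -> R,
    [/\ forall i, 0 <= a i, \sum_i a i = 1 & v = \sum_i a i *: P i]]).
  move=> _ _ t /andP[t0 t1] [a [a0 a1 ->]] [b [b0 b1 ->]].
  exists (fun i => t * a i + (1 - t) * b i); split.
  - by move=> i; rewrite addr_ge0 ?mulr_ge0 ?subr_ge0.
  - by rewrite big_split /= -!mulr_sumr a1 b1 !mulr1 subrKC.
  - rewrite !scaler_sumr -big_split; apply: eq_bigr => i _.
    by rewrite !scalerA /= -scalerDl.
move=> v /AP[i ->]; exists (fun j => (j == i)%:R); split.
- by move=> j; rewrite ler0n.
- by rewrite (bigD1 i) //= eqxx big1 ?addr0 // => j /negbTE ->.
- rewrite (bigD1 i) //= eqxx scale1r big1 ?addr0 // => j /negbTE ->.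
  by rewrite scale0r.
Qed.

End ConvexHull.

(** * Sharp minima *)

Section Sharp.
Context {R : realType} {d : nat} {I : finType}.
Local Notation vec := 'rV[R]_d.

(** Affine independence of [V] is linear independence of the vectors [(V i, 1)];
    there are [d + 1] of them in dimension [d + 1], so [(e, 0)] is one of their
    combinations. *)
Lemma aff_indep_span (S : {set I}) (V : I -> vec) (e : vec) :
  #|S| = d.+1 -> aff_indep S V ->
  exists2 c : I -> R, \sum_(i in S) c i = 0 & \sum_(i in S) c i *: V i = e.
Proof.
move=> cS aS; have [i0 i0S] : exists i, i \in S by apply/card_gt0P; rewrite cS.
pose rk := enum_rank_in i0S.
pose B : 'M[R]_(#|S|, d + 1) := \matrix_i row_mx (V (enum_val i)) 1.
have mulB (v : 'rV_#|S|) : v *m B =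
    row_mx (\sum_(i in S) v 0 (rk i) *: V i) (\sum_(i in S) v 0 (rk i))%:M.
  rewrite mulmx_sum_row (big_enum_val (fun i => v 0 (rk i) *: V i)).
  rewrite (big_enum_val (fun i => v 0 (rk i))) /=.
  under eq_bigr do rewrite rowK.
  elim/big_ind3 : _ => [|a b _ a' b' _ -> ->|i _].
  - by rewrite raddf0 row_mx0.
  - by rewrite add_row_mx raddfD.
  - by rewrite /rk enum_valK_in scale_row_mx -[in RHS]scalemx1.
have fB : row_full B.
  suff /eqP rB : row_free B by rewrite /row_full rB cS addn1.
  apply: inj_row_free => v.
  rewrite mulB -row_mx0 => /eq_row_mx[v0 v1].
  apply/rowP => j; rewrite mxE -[j](enum_valK_in i0S) -/rk.
  apply: (aS (fun i => v 0 (rk i))) => //; last exact: enum_valP.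
  by have /matrixP/(_ 0 0) := v1; rewrite !mxE eqxx mulr1n.
have /submxP[v] := submx_full (row_mx e 0) fB.
rewrite mulB => /eq_row_mx[ve v0]; exists (fun i => v 0 (rk i)) => //.
by have /matrixP/(_ 0 0) := v0; rewrite !mxE eqxx mulr1n.
Qed.

(** This is [`|h| / T <= max_(i in S) dotp (A i) h], the linear growth of a
    maximum of linear forms, phrased through the upper bounds of the maximum. *)
Definition sharp_dir (S : {set I}) (A : I -> vec) (T : R) :=
  forall h (M : R), (forall i, i \in S -> dotp (A i) h <= M) -> `|h| <= T * M.

Lemma near_ge_ratio (a b : R) : 0 < a -> \forall T \near +oo, b <= T * a.
Proof.
by move=> a0; near=> T; rewrite -ler_pdivrMr.
Unshelve. all: by end_near. Qed.

(** Every unit coordinate vector, and its opposite, is a combination of the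
    [V i + W]; adding a large multiple of the relation [a], whose coefficients
    are positive, makes the coefficients nonnegative without changing the
    combination.  Each coordinate of [h], up to sign, is thus a nonnegative
    combination of the slopes [dotp (V i + W) h]. *)
Lemma sharp_of_multipliers (S : {set I}) (V : I -> vec) (W : vec) (a : I -> R) :
  #|S| = d.+1 -> aff_indep S V ->
  (forall i, i \in S -> 0 < a i) -> \sum_(i in S) a i = 1 ->
  \sum_(i in S) a i *: (V i + W) = 0 ->
  \forall T \near +oo, sharp_dir S (fun i => V i + W) T.
Proof.
move=> cS aS a0 a1 aV0.
have [c cP] : exists c : 'I_d -> I -> R, forall j, \sum_(i in S) c j i = 0 /\
    \sum_(i in S) c j i *: V i = delta_mx 0 j.
  suff /choice[c cP] : forall j : 'I_d, exists c : I -> R,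
      \sum_(i in S) c i = 0 /\ \sum_(i in S) c i *: V i = delta_mx 0 j.
    by exists c.
  by move=> j; have [c c0 cV] := aff_indep_span (delta_mx 0 j) cS aS; exists c.
have big_T : \forall T \near +oo,
    forall j i, i \in S -> `|c j i| <= T * a i.
  apply: filter_forall => j; apply: filter_forall => i.
  have [iS|_] := boolP (i \in S); last by apply: nearW.
  by have := near_ge_ratio `|c j i| (a0 i iS); apply: filterS => T.
near=> T => h M hM.
have M0 : 0 <= M.
  rewrite -[0](dotp0l h) -aV0 dotp_suml -[leRHS]mul1r -a1 mulr_suml.
  by apply: ler_sum => i iS; rewrite ler_wpM2l ?hM // ltW // a0.
have T0 : 0 <= T by near: T; apply: nbhs_pinfty_ge.
apply: norm_le_coord => [|j]; first exact: mulr_ge0.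
have cT i : i \in S -> `|c j i| <= T * a i.
  by move=> iS; have : i \in S := iS; move: j i {iS}; near: T.
have key (e : R) : `|e| = 1 -> e * h 0 j <= T * M.
  move=> e1; have [c0 cV] := cP j.
  have -> : e * h 0 j = \sum_(i in S) (e * c j i + T * a i) * dotp (V i + W) h.
    rewrite -dotp_suml; under eq_bigr do rewrite scalerDl -!scalerA.
    rewrite big_split /= -!scaler_sumr aV0 scaler0 addr0 dotpZl; congr (_ * _).
    under eq_bigr do rewrite scalerDr.
    by rewrite big_split /= -scaler_suml c0 scale0r addr0 cV dotp_delta.
  have -> : T * M = \sum_(i in S) (e * c j i + T * a i) * M.
    by rewrite -mulr_suml big_split /= -!mulr_sumr c0 a1 mulr0 add0r mulr1.
  apply: ler_sum => i iS; rewrite ler_wpM2l ?hM //.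
  have := cT i iS; rewrite -[`|_|]mul1r -e1 -normrM ler_norml => /andP[+ _].
  lra.
rewrite ler_norml -lerNl -mulN1r -[h 0 j in X in _ && X]mul1r.
by rewrite !key ?normrN ?normr1.
Unshelve. all: by end_near. Qed.

End Sharp.

(** * Pieces of the objective and the quadratic model *)

Section PieceLemmas.
Context {R : realType} {d n : nat}.
Local Notation vec := 'rV[R]_d.
Implicit Types (G U : 'I_n.+1 -> vec -> R) (x xs : vec).

Lemma le_fmax G x i : G i x <= fmax G x.
Proof. exact: (le_bigmax _ (G^~ x)). Qed.

Lemma fmin_le U x j : fmin U x <= U j x.
Proof. exact: (bigmin_le _ _ (U^~ x)). Qed.

Lemma mem_act_max0 G x i : (i \in act_max G 0%E x) = (fmax G x <= G i x).
Proof. by rewrite inE sube0 lee_fin. Qed.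

Lemma mem_act_max_pinfty G x i : i \in act_max G +oo%E x.
Proof. by rewrite inE /= leNye. Qed.

Lemma mem_act_min0 U x j : (j \in act_min U 0%E x) = (U j x <= fmin U x).
Proof. by rewrite inE adde0 lee_fin. Qed.

Lemma act_minS U (mu : \bar R) x : (0%E <= mu)%E ->
  act_min U 0%E x \subset act_min U mu x.
Proof.
move=> mu0; apply/fintype.subsetP => j; rewrite !inE adde0 => /le_trans; apply.
by rewrite -[leLHS]adde0 leeD.
Qed.

Lemma act_max0_nonempty G x : exists i, i \in act_max G 0%E x.
Proof.
have /bigmax_geP[H|[i _ H]] := lexx (fmax G x).
  by exists ord0; rewrite mem_act_max0.
by exists i; rewrite mem_act_max0.
Qed.

Lemma act_min0_nonempty U x : exists j, j \in act_min U 0%E x.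
Proof.
have /bigmin_leP[H|[j _ H]] := lexx (fmin U x).
  by exists ord0; rewrite mem_act_min0.
by exists j; rewrite mem_act_min0.
Qed.

(** By continuity, a piece that is inactive at [xs] stays strictly above a piece
    that is active at [xs]. *)
Lemma near_act_min U xs : (forall j, {for xs, continuous (U j)}) ->
  \forall y \near xs, act_min U 0%E y \subset act_min U 0%E xs.
Proof.
move=> cU; have [j0 j0P] := act_min0_nonempty U xs.
suff : \forall y \near xs, forall j, j \in act_min U 0%E y -> j \in act_min U 0%E xs.
  by apply: filterS => y H; apply/fintype.subsetP.
apply: (@filter_forall _ _ (fun j y => j \in act_min U 0%E y ->
  j \in act_min U 0%E xs) (nbhs xs)) => j.
have [?|jN] := boolP (j \in act_min U 0%E xs); first exact: nearW.
have lt0 : 0 < U j xs - U j0 xs.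
  rewrite subr_gt0; move: jN j0P; rewrite !mem_act_min0 -ltNge => H1 H2.
  exact: le_lt_trans H1.
have cUU : (fun y => U j y - U j0 y) @ xs --> U j xs - U j0 xs.
  exact: (cvgB (cU j) (cU j0)).
have : \forall y \near xs, 0 < U j y - U j0 y.
  exact: (cvgr_gt _ cUU).
apply: filterS => y; rewrite subr_gt0 mem_act_min0 => lty jy.
by have := lt_le_trans lty (le_trans jy (fmin_le U y j0)); rewrite ltxx.
Qed.

End PieceLemmas.

Section ObjectiveAndModel.
Context {R : realType} {d m s : nat} {p : 'I_m -> nat} {q : 'I_s -> nat}.
Local Notation vec := 'rV[R]_d.
Local Notation pt := (R^o * vec)%type.
Variable g : forall k : 'I_m, 'I_(p k).+1 -> vec -> R.
Variable u : forall l : 'I_s, 'I_(q l).+1 -> vec -> R.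
Implicit Types (x y xs h : vec) (zeta : @idxI m p) (la : @idxJ s q).

(** The smooth functions of which the objective is a minimum of maxima. *)
Definition branch zeta la x : R :=
  \sum_k g (zeta k) x + \sum_l u (la l) x.

Definition branch_grad zeta la x : vec :=
  grad_sum g zeta x + \sum_l grad (u (la l)) x.

Lemma Iact_nonempty x : exists zeta, zeta \in Iact g x.
Proof.
have H k : exists i, i \in act_max (@g k) 0%E x := act_max0_nonempty (@g k) x.
exists [ffun k => xchoose (H k)]; rewrite inE; apply/forallP => k.
by rewrite ffunE; apply: xchooseP.
Qed.

Lemma Jact_nonempty x : exists la, la \in Jact u x.
Proof.
have H l : exists j, j \in act_min (@u l) 0%E x := act_min0_nonempty (@u l) x.
exists [ffun l => xchoose (H l)]; rewrite inE; apply/forallP => l.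
by rewrite ffunE; apply: xchooseP.
Qed.

Lemma Iact_sum zeta x : zeta \in Iact g x ->
  \sum_k g (zeta k) x = \sum_k fmax (@g k) x.
Proof.
rewrite inE => /forallP act; apply: eq_bigr => k _; apply/le_anti.
by rewrite le_fmax -mem_act_max0 act.
Qed.

Lemma Jact_sum la x : la \in Jact u x ->
  \sum_l u (la l) x = \sum_l fmin (@u l) x.
Proof.
rewrite inE => /forallP act; apply: eq_bigr => l _; apply/le_anti.
by rewrite fmin_le -mem_act_min0 act.
Qed.

Lemma branch_le_obj zeta la x : la \in Jact u x -> branch zeta la x <= obj g u x.
Proof.
move=> laJ; rewrite /branch Jact_sum // lerD2r.
by apply: ler_sum => k _; apply: le_fmax.
Qed.

Lemma obj_le_branch zeta la x : zeta \in Iact g x -> obj g u x <= branch zeta la x.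
Proof.
move=> zI; rewrite /branch Iact_sum // lerD2l.
by apply: ler_sum => l _; apply: fmin_le.
Qed.

Lemma obj_eq_branch zeta la x : zeta \in Iact g x -> la \in Jact u x ->
  branch zeta la x = obj g u x.
Proof. by move=> zI laJ; rewrite /branch Iact_sum ?Jact_sum. Qed.

Lemma near_Jact xs : (forall l j, {for xs, continuous (@u l j)}) ->
  \forall y \near xs, {subset Jact u y <= Jact u xs}.
Proof.
move=> cu; have : \forall y \near xs, forall l,
    act_min (@u l) 0%E y \subset act_min (@u l) 0%E xs.
  apply: (@filter_forall _ _ (fun l y => act_min (@u l) 0%E y \subset
    act_min (@u l) 0%E xs) (nbhs xs)) => l.
  exact: near_act_min.
apply: filterS => y sub la; rewrite inE => /forallP act; rewrite inE.
by apply/forallP => l; apply: (fintype.subsetP (sub l)); apply: act.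
Qed.

Lemma sum_pair (I : finType) (a : I -> R^o) (v : I -> vec) :
  \sum_i ((a i, v i) : pt) = (\sum_i a i, \sum_i v i).
Proof.
by rewrite unlock; elim: (index_enum I) => //= i r ->.
Qed.

(** The vertices of the codifferentials, indexed by the choices of pieces. *)
Definition lower_pt zeta x : pt :=
  (\sum_k (g (zeta k) x - fmax (@g k) x), grad_sum g zeta x).

Definition upper_pt la x : pt :=
  (\sum_l (u (la l) x - fmin (@u l) x), \sum_l grad (u (la l)) x).

Lemma lower_codiffP x w :
  lower_codiff g +oo%E x w <-> exists zeta, w = lower_pt zeta x.
Proof.
split=> [[v vP <-]|[zeta ->]].
  have H k : exists i : 'I_(p k).+1, v k == (g i x - fmax (@g k) x, grad (g i) x).
    by have [i _ <-] := vP k; exists i.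
  exists [ffun k => xchoose (H k)].
  rewrite /lower_pt /grad_sum -sum_pair; apply: eq_bigr => k _.
  by rewrite ffunE; apply/eqP/(xchooseP (H k)).
exists (fun k => (g (zeta k) x - fmax (@g k) x, grad (g (zeta k)) x)).
  by move=> k; exists (zeta k) => //; apply: mem_act_max_pinfty.
exact: sum_pair.
Qed.

Lemma upper_ptP la (mu : \bar R) x : (0%E <= mu)%E -> la \in Jact u x ->
  upper_codiff u mu x (upper_pt la x).
Proof.
rewrite inE => mu0 /forallP act.
exists (fun l => (u (la l) x - fmin (@u l) x, grad (u (la l)) x)).
  move=> l; exists (la l) => //; apply: (fintype.subsetP (act_minS _ _ mu0)).
  exact: act.
exact: sum_pair.
Qed.

(** The maximum of an affine function over a convex hull is attained at the
    generators.  This gives both the finiteness and the value of the supremum in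
    the model. *)
Lemma lower_hull_le (w : pt) x h (M : R) :
  (forall zeta, (lower_pt zeta x + w).1 + dotp (lower_pt zeta x + w).2 h <= M) ->
  forall v, conv_hull (lower_codiff g +oo%E x) v ->
    (v + w).1 + dotp (v + w).2 h <= M.
Proof.
move=> ptM; apply: conv_hull_sub => [v1 v2 t /andP[t0 t1] H1 H2|].
  have -> : (t *: v1 + (1 - t) *: v2 + w).1 +
      dotp (t *: v1 + (1 - t) *: v2 + w).2 h =
      t * ((v1 + w).1 + dotp (v1 + w).2 h) +
      (1 - t) * ((v2 + w).1 + dotp (v2 + w).2 h).
    by rewrite /= !dotpDl !dotpZl; rewrite /GRing.scale /=; ring.
  have : t * ((v1 + w).1 + dotp (v1 + w).2 h) <= t * M by rewrite ler_wpM2l.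
  have : (1 - t) * ((v2 + w).1 + dotp (v2 + w).2 h) <= (1 - t) * M.
    by rewrite ler_wpM2l ?subr_ge0.
  rewrite /=; lra.
by move=> _ /lower_codiffP[zeta ->]; apply: ptM.
Qed.

Lemma qr_model_le (w : pt) x h (M : R) :
  (forall zeta, (lower_pt zeta x + w).1 + dotp (lower_pt zeta x + w).2 h <= M) ->
  qr_model g +oo%E x w h <= M + 2^-1 * enorm h ^+ 2.
Proof.
move=> ptM; rewrite lerD2r; apply: ge_sup.
  have [zeta _] := Iact_nonempty x.
  exists ((lower_pt zeta x + w).1 + dotp (lower_pt zeta x + w).2 h).
  exists (lower_pt zeta x + w) => //; exists (lower_pt zeta x) => //.
  by apply: sub_conv_hull; apply/lower_codiffP; exists zeta.
by move=> _ [_ [v vP <-] <-]; apply: (lower_hull_le ptM).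
Qed.

Lemma qr_model_ge (w : pt) x h zeta :
  (lower_pt zeta x + w).1 + dotp (lower_pt zeta x + w).2 h
    + 2^-1 * enorm h ^+ 2 <= qr_model g +oo%E x w h.
Proof.
pose F zeta : R := (lower_pt zeta x + w).1 + dotp (lower_pt zeta x + w).2 h.
rewrite lerD2r; apply: ub_le_sup.
  exists (\big[Num.max/0]_zeta F zeta) => _ [_ [v vP <-] <-].
  apply: lower_hull_le vP => zeta'.
  exact: (le_bigmax 0 F zeta').
exists (lower_pt zeta x + w) => //; exists (lower_pt zeta x) => //.
by apply: sub_conv_hull; apply/lower_codiffP; exists zeta.
Qed.

(** Up to the constant [obj g u x], the model is the maximum over [zeta] of the
    linearised branches plus the quadratic term; comparing its minimizer [h] with
    any [h'] cancels the constant. *)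
Lemma model_argmin x h la (M : R) h' :
  argmin setT (qr_model g +oo%E x (upper_pt la x)) h ->
  (forall zeta, branch zeta la x + dotp (branch_grad zeta la x) h' <= M) ->
  forall zeta, branch zeta la x + dotp (branch_grad zeta la x) h
    + 2^-1 * enorm h ^+ 2 <= M + 2^-1 * enorm h' ^+ 2.
Proof.
move=> [_ minh] leM zeta.
have ptE zeta' h0 : (lower_pt zeta' x + upper_pt la x).1 +
    dotp (lower_pt zeta' x + upper_pt la x).2 h0 =
    branch zeta' la x + dotp (branch_grad zeta' la x) h0 - obj g u x.
  by rewrite /= !sumrB /branch /obj /branch_grad; ring.
have := le_trans (qr_model_ge _ x h zeta) (minh h' I).
move=> /le_trans /(_ (@qr_model_le _ _ _ (M - obj g u x) _)).
rewrite ptE; set c := obj g u x => H.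
suff : forall zeta', (lower_pt zeta' x + upper_pt la x).1 +
    dotp (lower_pt zeta' x + upper_pt la x).2 h' <= M - c by move=> /H; lra.
by move=> zeta'; rewrite ptE lerD2r.
Qed.

(** A vanishing element of the codifferential is a convex combination of the
    vertices [lower_pt zeta xs].  Their first components are nonpositive, and
    zero only for active [zeta]; as the combination of first components
    vanishes, the weights of the inactive multi-indices are zero. *)
Lemma haar_multipliers la xs : codiff_la g u la xs 0 ->
  exists al, multipliers g u la xs al.
Proof.
move=> [w /minkowski_conv_hull whull w0].
have [|al [al0 al1 wE]] := @conv_hull_finite _ _ _ (lower_pt^~ xs) _ w _ whull.
  by move=> v /lower_codiffP.
have sumE : \sum_zeta al zeta *: lower_pt zeta xs =
    (\sum_zeta al zeta * (lower_pt zeta xs).1, \sum_zeta al zeta *: grad_sum g zeta xs).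
  exact: sum_pair.
move: w0; rewrite wE sumE => -[]; rewrite addr0 => s0 v0.
exists al; split => // zeta zN.
have le0 zeta' : al zeta' * (lower_pt zeta' xs).1 <= 0.
  by rewrite mulr_ge0_le0 // sumr_le0 // => k _; rewrite subr_le0 le_fmax.
have : al zeta * (lower_pt zeta xs).1 = 0.
  apply/eqP; rewrite -oppr_eq0; move/eqP: s0; rewrite -oppr_eq0 -sumrN psumr_eq0.
    by move=> /allP/(_ zeta); rewrite mem_index_enum => /(_ isT).
  by move=> zeta' _; rewrite oppr_ge0.
move/eqP; rewrite mulf_eq0 => /orP[/eqP//|/eqP pt0]; case/negP: zN.
rewrite inE; apply/forallP => k; rewrite mem_act_max0 -subr_ge0.
move/eqP: pt0; rewrite -oppr_eq0 -sumrN psumr_eq0 => [/allP/(_ k)|k' _].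
  by rewrite mem_index_enum oppr_eq0 => /(_ isT)/eqP->.
by rewrite oppr_ge0 subr_le0 le_fmax.
Qed.

Lemma haar_sharp la xs : haar_point g u la xs ->
  \forall T \near +oo,
    sharp_dir (Iact g xs) (fun zeta => branch_grad zeta la xs) T.
Proof.
move=> [/haar_multipliers[al mal] cI aI /(_ _ mal) al0].
have [_ alN al1 alV] := mal.
have sum1 : \sum_(zeta in Iact g xs) al zeta = 1.
  by rewrite big_rmcond.
apply: (sharp_of_multipliers cI aI al0 sum1).
under eq_bigr do rewrite scalerDr.
rewrite big_split -scaler_suml /= sum1 scale1r big_rmcond //.
by move=> zeta /alN ->; rewrite scale0r.
Qed.

End ObjectiveAndModel.

(** * Local error estimates and convergence *)

Section LocalEstimates.
Context {R : realType} {d m s : nat} {p : 'I_m -> nat} {q : 'I_s -> nat}.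
Local Notation vec := 'rV[R]_d.
Variable g : forall k : 'I_m, 'I_(p k).+1 -> vec -> R.
Variable u : forall l : 'I_s, 'I_(q l).+1 -> vec -> R.
Variables (xs : vec) (K r T : R).
Hypotheses (K_gt0 : 0 < K) (r_gt0 : 0 < r) (T_gt0 : 0 < T).
Hypothesis branch_taylor :
  forall zeta la, taylor K r xs (branch g u zeta la) (branch_grad g u zeta la).
Hypothesis sharp : forall la, la \in Jact u xs ->
  sharp_dir (Iact g xs) (fun zeta => branch_grad g u zeta la xs) T.

Lemma near_norm_lt (e : R) : 0 < e -> \forall y \near xs, `|y - xs| < e.
Proof.
by move=> e0; near do rewrite distrC; apply: cvgr_dist_lt.
Unshelve. all: by end_near. Qed.

(** With [la] active at [y] the value [obj g u y] bounds all its branches; the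
    active ones start from [obj g u xs] with slopes controlled by [sharp], and
    the quadratic remainder is absorbed once [`|y - xs|] is small. *)
Lemma obj_sharp : (\forall y \near xs, {subset Jact u y <= Jact u xs}) ->
  \forall y \near xs, `|y - xs| <= 2 * T * (obj g u y - obj g u xs).
Proof.
move=> nJ; near=> y.
have yr : ball xs r y by near: y; exact: nbhsx_ballx.
have [la laJy] := Jact_nonempty u y.
have sub : {subset Jact u y <= Jact u xs} by near: y.
have laJ := sub _ laJy.
have : `|y - xs| <= T * (obj g u y - obj g u xs + K * `|y - xs| ^+ 2).
  apply: (sharp laJ) => zeta zI.
  have [+ _] := branch_taylor zeta la (ballxx xs r_gt0) yr.
  rewrite (obj_eq_branch zI laJ) ler_norml => /andP[+ _].
  have := branch_le_obj g zeta laJy; lra.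
have : T * K * `|y - xs| <= 2^-1.
  rewrite -ler_pdivlMl ?mulr_gt0 //; apply/ltW; near: y; apply: near_norm_lt.
  by rewrite mulr_gt0 ?invr_gt0 ?mulr_gt0.
have := normr_ge0 (y - xs); set a := `|y - xs|; set D := _ - _.
nra.
Unshelve. all: by end_near. Qed.

(** A fixed [la] active at [xs] bounds the objective above by a maximum of
    finitely many smooth branches, none of which exceeds [obj g u xs] at [xs]. *)
Lemma obj_calm : exists2 M : R, 0 < M &
  \forall y \near xs, obj g u y <= obj g u xs + M * `|y - xs|.
Proof.
have [la laJ] := Jact_nonempty u xs.
pose A := \sum_zeta `|branch_grad g u zeta la xs|.
have A0 : 0 <= A by apply: sumr_ge0.
exists (d%:R * A + K); first by rewrite ltr_wpDl // mulr_ge0.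
near=> y.
have yr : ball xs r y by near: y; exact: nbhsx_ballx.
have y1 : `|y - xs| <= 1 by apply/ltW; near: y; apply: near_norm_lt.
have [zeta zI] := Iact_nonempty g y.
apply: le_trans (obj_le_branch u la zI) _.
have [+ _] := branch_taylor zeta la (ballxx xs r_gt0) yr.
rewrite ler_norml => /andP[_].
have := branch_le_obj g zeta laJ.
have : dotp (branch_grad g u zeta la xs) (y - xs) <= d%:R * (A * `|y - xs|).
  apply: le_trans (ler_norm _) _; apply: le_trans (dotp_le _ _) _.
  rewrite ler_wpM2l // ler_wpM2r // /A (bigD1 zeta) //= lerDl.
  exact: sumr_ge0.
have : K * `|y - xs| ^+ 2 <= K * `|y - xs|.
  by rewrite ler_wpM2l ?(ltW K_gt0) // expr2 ler_piMl.
lra.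
Unshelve. all: by end_near. Qed.

(** The vector [e = xs - y] leads exactly to [xs], where the model, up to its
    constant term, is at most [obj g u xs + O(`|e|^2)].  The minimizer [h] does no worse, and by
    sharpness the model grows linearly in [h - e], whence [h - e] has the size of
    the quadratic errors. *)
Lemma model_step_error : \forall y \near xs, forall la h, la \in Jact u xs ->
  argmin setT (qr_model g +oo%E y (upper_pt u la y)) h ->
  `|y + h - xs| <= T * (4 * K + d%:R) * `|y - xs| ^+ 2.
Proof.
have c0 : 0 < T * d%:R * K + 1 by rewrite ltr_wpDl // !mulr_ge0 // ltW.
near=> y; move=> la h laJ minh.
have yr : ball xs r y by near: y; exact: nbhsx_ballx.
have xr := ballxx xs r_gt0.
pose e := xs - y; pose a := `|y - xs|.
have a0 : 0 <= a by exact: normr_ge0.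
have ae : `|e| = a by rewrite /e distrC.
have le_e zeta : branch g u zeta la y + dotp (branch_grad g u zeta la y) e <=
    obj g u xs + K * a ^+ 2.
  have [+ _] := branch_taylor zeta la yr xr.
  rewrite -/e ae ler_norml => /andP[+ _].
  have := branch_le_obj g zeta laJ; lra.
have le_h := model_argmin minh le_e.
have e2 : enorm e ^+ 2 <= d%:R * a ^+ 2.
  rewrite sqr_enorm; apply: le_trans (ler_norm _) _.
  by rewrite expr2 -ae dotp_le.
have h2 : 0 <= enorm h ^+ 2 by rewrite sqr_ge0.
pose t := h - e.
have -> : y + h - xs = t by rewrite /t /e opprB addrA [h + y]addrC.
(* [K * a ^+ 2] once to bound the model at [e] from above and once to bound it at
   [h] from below, [d / 2] for the regularisation at [e], and the last term for
   moving the gradients from [y] to [xs]. *)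
have : `|t| <= T * ((2 * K + d%:R / 2) * a ^+ 2 + d%:R * (K * a * `|t|)).
  apply: (sharp laJ) => zeta zI.
  have [t1 _] := branch_taylor zeta la yr xr.
  have [_ t2] := branch_taylor zeta la xr yr.
  have := le_h zeta; rewrite -[h](subrK e) -/t dotpDr.
  move: t1; rewrite -/e ae (obj_eq_branch zI laJ) ler_norml => /andP[_].
  have : dotp (branch_grad g u zeta la xs) t - dotp (branch_grad g u zeta la y) t
      <= d%:R * (K * a * `|t|).
    rewrite -dotpBl; apply: le_trans (ler_norm _) _.
    apply: le_trans (dotp_le _ _) _; apply: ler_wpM2l; first exact: ler0n.
    by apply: ler_wpM2r; [exact: normr_ge0|rewrite distrC].
  rewrite subrK; lra.
(* The term in [`|t|] on the right is absorbed by half of the left-hand side. *)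
have : T * d%:R * K * a <= 2^-1.
  apply: (@le_trans _ _ ((T * d%:R * K + 1) * a)).
    by rewrite ler_wpM2r // lerDl.
  rewrite -ler_pdivlMl // /a; apply/ltW; near: y; apply: near_norm_lt.
  by rewrite mulr_gt0 ?invr_gt0.
have := normr_ge0 t; set b := `|t|; set A := a ^+ 2.
rewrite /a; nra.
Unshelve. all: by end_near. Qed.

End LocalEstimates.

Theorem theorem8 (R : realType) (d m s : nat)
    (p : 'I_m -> nat) (q : 'I_s -> nat)
    (g : forall k : 'I_m, 'I_(p k).+1 -> 'rV[R]_d -> R)
    (u : forall l : 'I_s, 'I_(q l).+1 -> 'rV[R]_d -> R)
    (g_C1 : forall k i, C1 (g k i))
    (g_lip : forall k i, loc_lipschitz_grad (g k i))
    (u_C1 : forall l j, C1 (u l j))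
    (u_lip : forall l j, loc_lipschitz_grad (u l j))
    (nu mu : nat -> \bar R) (mu_lim alpha_max : \bar R)
    (alpha_max_ge1 : (1%:E <= alpha_max)%E)
    (nu_infty : forall n, nu n = +oo%E)
    (mu_ge0 : forall n, (0%E <= mu n)%E)
    (mu_cvg : mu @ \oo --> mu_lim) (mu_lim_gt0 : (0%E < mu_lim)%E)
    (x : nat -> 'rV[R]_d) (xs : 'rV[R]_d)
    (x_qr_mcd : qr_mcd g u nu mu alpha_max x)
    (x_cvg : x @ \oo --> xs)
    (xs_haar : forall la, la \in Jact u xs -> haar_point g u la xs) :
  strict_local_min (obj g u) xs /\ cvg_quadratically x xs.
Proof.
have ht (pr : @idxI m p * @idxJ s q) :
    has_taylor xs (branch g u pr.1 pr.2) (branch_grad g u pr.1 pr.2).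
  apply: has_taylorD; apply: has_taylor_sum => i; exact: C1_has_taylor.
have [K [r [K0 r0 Kr]]] := has_taylor_uniform ht.
have {ht}taylorKr zeta la : taylor K r xs (branch g u zeta la)
    (branch_grad g u zeta la) := Kr (zeta, la).
have [T T0 sharpT] : exists2 T : R, 0 < T & forall la, la \in Jact u xs ->
    sharp_dir (Iact g xs) (fun zeta => branch_grad g u zeta la xs) T.
  have : \forall T \near +oo, forall la, la \in Jact u xs ->
      sharp_dir (Iact g xs) (fun zeta => branch_grad g u zeta la xs) T.
    apply: filter_forall => la.
    have [laJ|_] := boolP (la \in Jact u xs); last exact: nearW.
    by have := haar_sharp (xs_haar la laJ); apply: filterS => T sT _.
  move=> nT; have [T [T0 sT]] := filter_ex (filterI (nbhs_pinfty_gt (num_real 0)) nT).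
  by exists T.
have nJ : \forall y \near xs, {subset Jact u y <= Jact u xs}.
  apply: near_Jact => l j; apply: differentiable_continuous.
  by case: (u_C1 l j).
have growth := obj_sharp K0 r0 T0 taylorKr sharpT nJ.
have [M M0 calm] := obj_calm K0 r0 taylorKr.
have step := model_step_error K0 r0 T0 taylorKr sharpT.
split.
  rewrite /strict_local_min near_withinE; near=> y => yxs.
  have : `|y - xs| <= 2 * T * (obj g u y - obj g u xs) by near: y.
  have : 0 < `|y - xs| by rewrite normr_gt0 subr_eq0.
  move=> /lt_le_trans/[apply]; rewrite pmulr_rgt0 ?subr_gt0 //.
  exact: mulr_gt0.
split=> //; pose C := T * (4 * K + d%:R).
have C0 : 0 < C by rewrite mulr_gt0 // ltr_pwDl // mulr_gt0.
have [del /= del0 calmB] := (nbhs_ballP _ _).1 calm.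
(* [2 * T] from the linear growth, [M] from the calmness, [C] from the step. *)
pose C' := 2 * T * (M * C).
have C'0 : 0 < C' by apply: mulr_gt0; apply: mulr_gt0.
(* The factor [d] comes from the two norms; [+ 1] covers the case [d = 0]. *)
exists (d%:R * C' + 1); first by rewrite ltr_wpDl // mulr_ge0 // ltW.
have [h [alpha [z mcd]]] := x_qr_mcd.
have near_x P : (\forall y \near xs, P y) -> \forall n \near \oo, P (x n).
  exact: x_cvg.
have near_xS P : (\forall y \near xs, P y) -> \forall n \near \oo, P (x n.+1).
  by have := x_cvg; rewrite -cvg_shiftS; apply.
have lt_near (e : R) : 0 < e -> \forall n \near \oo, `|x n - xs| < e.
  by move=> e0; apply: (near_x (fun y => `|y - xs| < e)); apply: near_norm_lt.
have growth' := near_xS _ growth.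
have step' := near_x _ step.
have nJ' := near_x _ nJ.
near=> n.
have [hmin amin zmin xE] := mcd n.
pose a := `|x n - xs|.
have a0 : 0 <= a by exact: normr_ge0.
have [la laJn] := Jact_nonempty u (x n).
have sub : {subset Jact u (x n) <= Jact u xs} by near: n.
have laJ := sub _ laJn; pose w := upper_pt u la (x n).
have wU : upper_codiff u (mu n) (x n) w by apply: upper_ptP.
have err : `|x n + h n w - xs| <= C * a ^+ 2.
  have Hs : forall la h, la \in Jact u xs ->
      argmin setT (qr_model g +oo%E (x n) (upper_pt u la (x n))) h ->
      `|x n + h - xs| <= C * `|x n - xs| ^+ 2 by near: n.
  apply: Hs laJ _; by rewrite -/w -(nu_infty n) hmin.
(* The point [x n + h n w] is a candidate for the line search along [h n w],
   itself a candidate in the choice of [z n]. *)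
have decrease : obj g u (x n.+1) <= obj g u (x n + h n w).
  rewrite xE; apply: le_trans (zmin.2 _ wU) _.
  by have := (amin _ wU).2 1; rewrite scale1r; apply; split.
have close : ball xs del (x n + h n w).
  have a1 : a <= 1 by apply/ltW; rewrite /a; near: n; apply: lt_near.
  have aC : C * a < del.
    by rewrite -ltr_pdivlMl // /a; near: n; apply: lt_near; rewrite mulr_gt0 ?invr_gt0.
  rewrite -ball_normE /ball_ /= distrC; apply: le_lt_trans err _.
  by apply: le_lt_trans aC; rewrite ler_wpM2l ?(ltW C0) // expr2 ler_piMl.
have grow : `|x n.+1 - xs| <= 2 * T * (obj g u (x n.+1) - obj g u xs) by near: n.
have main : `|x n.+1 - xs| <= C' * a ^+ 2.
  apply: le_trans grow _; rewrite /C' -2!mulrA -[leRHS]mulrA ler_wpM2l //.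
  rewrite ler_wpM2l ?(ltW T0) // -mulrA lerBlDl.
  apply: le_trans decrease _; apply: le_trans (calmB _ close) _.
  by rewrite lerD2l ler_wpM2l ?(ltW M0).
apply: le_trans (enorm_le_norm _) _.
have ae : a ^+ 2 <= enorm (x n - xs) ^+ 2.
  by rewrite ler_sqr ?nnegrE ?sqrtr_ge0 // norm_le_enorm.
have : d%:R * `|x n.+1 - xs| <= d%:R * C' * a ^+ 2 by rewrite -mulrA ler_wpM2l.
move=> /le_trans; apply.
apply: (@le_trans _ _ ((d%:R * C' + 1) * a ^+ 2)).
  by rewrite ler_wpM2r ?sqr_ge0 // lerDl.
by rewrite ler_wpM2l // addr_ge0 // mulr_ge0 // ltW.
Unshelve. all: by end_near. Qed.
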